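(* Let $(H;\langle\cdot,\cdot\rangle)$ be an infinite dimensional Hilbert space over the real or complex number field $\mathbb{K}$ and $(e_i)_{i\in\mathbb{N}}$ an orthonormal family in $H$. Suppose that $\boldsymbol\Gamma=(\Gamma_i)_{i\in\mathbb{N}}\in\ell^2(\mathbb{K})$ and $\boldsymbol\gamma=(\gamma_i)_{i\in\mathbb{N}}\in\ell^2(\mathbb{K})$ are such that $$\sum_{i=1}^\infty\operatorname{Re}(\Gamma_i\overline{\gamma_i})>0 .$$ If $x\in H$ is such that either $$\left\|x-\sum_{i=1}^\infty\frac{\Gamma_i+\gamma_i}{2}e_i\right\|\le\frac12\left(\sum_{i=1}^\infty|\Gamma_i-\gamma_i|^2\right)^{\frac12}$$ or, equivalently, $$\operatorname{Re}\left\langle\sum_{i=1}^\infty\Gamma_ie_i-x,\;x-\sum_{i=1}^\infty\gamma_ie_i\right\rangle\ge0$$ holds, then $$\|x\|^2\le\frac14\cdot\frac{\left(\sum_{i=1}^\infty\operatorname{Re}[(\overline{\Gamma_i}+\overline{\gamma_i})\langle x,e_i\rangle]\right)^2}{\sum_{i=1}^\infty\operatorname{Re}(\Gamma_i\overline{\gamma_i})}\le\frac14\cdot\frac{\left|\sum_{i=1}^\infty(\overline{\Gamma_i}+\overline{\gamma_i})\langle x,e_i\rangle\right|^2}{\sum_{i=1}^\infty\operatorname{Re}(\Gamma_i\overline{\gamma_i})}\le\frac14\cdot\frac{\sum_{i=1}^\infty|\Gamma_i+\gamma_i|^2}{\sum_{i=1}^\infty\operatorname{Re}(\Gamma_i\overline{\gamma_i})}\sum_{i=1}^\infty|\langle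 x,e_i\rangle|^2 .$$ The constant $\frac14$ is best possible in all these inequalities (i.e. in each of the three upper bounds for $\|x\|^2$). We also have $$0\le\|x\|^2-\sum_{i=1}^\infty|\langle x,e_i\rangle|^2\le\frac14\cdot\frac{\sum_{i=1}^\infty|\Gamma_i-\gamma_i|^2}{\sum_{i=1}^\infty\operatorname{Re}(\Gamma_i\overline{\gamma_i})}\sum_{i=1}^\infty|\langle x,e_i\rangle|^2 .$$ Here the constant $\frac14$ is also best possible.
   Context: The inner product is linear in its first argument and $\|z\|=\sqrt{\langle z,z\rangle}$. The family $(e_i)_{i\in\mathbb{N}}$ is orthonormal (not assumed complete): $\langle e_i,e_j\rangle=0$ for $i\ne j$ and $\|e_i\|=1$. $\ell^2(\mathbb{K})$ is the space of sequences $(a_i)_{i\in\mathbb{N}}$ in $\mathbb{K}$ with $\sum_{i=1}^\infty|a_i|^2<\infty$; for $(a_i)\in\ell^2(\mathbb{K})$ the series $\sum_{i=1}^\infty a_ie_i$ converges in $H$. A constant is called best possible if no smaller constant makes the corresponding inequality valid for all $H$, $(e_i)$, $\boldsymbol\Gamma$, $\boldsymbol\gamma$, $x$ satisfying the hypotheses. *)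

(* Defs.v *)
From HB Require Import structures.
From mathcomp Require Import all_boot all_order all_algebra.
From mathcomp Require Import complex.
From mathcomp Require Import all_classical all_reals all_analysis.
Set Implicit Arguments.
Unset Strict Implicit.
Unset Printing Implicit Defensive.
Import Order.TTheory GRing.Theory Num.Theory.
Import numFieldNormedType.Exports.
Local Open Scope classical_set_scope.
Local Open Scope ring_scope.

(* The analogue in ring_scope of the notation that the library provides for
   extended reals: the limit of the partial sums.  It is meaningful only for
   convergent series; all the series below converge for square-summable
   coefficients and an orthonormal family. *)
Notation "\sum_ ( i <oo ) F" :=
  (\big[+%R/0%R]_(0 <= i <oo) F%R) : ring_scope.

Inductive scalar_kind := RealScalars | ComplexScalars.

Definition RC_field (R : realType) (k : scalar_kind) : numFieldType :=
  match k with
  | RealScalars => R : numFieldType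
  | ComplexScalars => R[i] : numFieldType
  end.

Definition RC_conj (R : realType) (k : scalar_kind) : RC_field R k -> RC_field R k :=
  match k with
  | RealScalars => fun z : R => z
  | ComplexScalars => fun z : R[i] => conjc z
  end.

Definition RC_re (R : realType) (k : scalar_kind) : RC_field R k -> R :=
  match k with
  | RealScalars => fun z : R => z
  | ComplexScalars => fun z : R[i] => complex.Re z
  end.

(* The library's norm takes its values in the scalar field itself (as
   nonnegative reals inside R[i] when k = ComplexScalars); rnorm is the same
   norm as an element of R.  It is used both for scalars and for vectors. *)
Definition rnorm (R : realType) (k : scalar_kind)
    (V : normedZmodType (RC_field R k)) (v : V) : R := RC_re `|v|.

(* inner is linear in its first argument and conjugate-linear in the second. *)
Record hilbertSpace (R : realType) (k : scalar_kind) := HilbertSpace {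
  hilbert_sort :> completeNormedModType (RC_field R k) ;
  inner : {dot hilbert_sort for @RC_conj R k} ;
  rnormE : forall x : hilbert_sort, rnorm x = Num.sqrt (RC_re (inner x x))
}.

Section Hypotheses.
Variables (R : realType) (k : scalar_kind).
Local Notation K := (RC_field R k).

Definition ell2 (a : nat -> K) : Prop :=
  cvgn (series (fun i => rnorm (a i) ^+ 2)).

Variable H : hilbertSpace R k.

Definition infinite_dimensional : Prop :=
  forall (n : nat) (f : 'I_n -> H),
    exists x : H, forall a : 'I_n -> K, x <> \sum_(i < n) a i *: f i.

Definition orthonormal_family (e : nat -> H) : Prop :=
  (forall i j, i <> j -> inner H (e i) (e j) = 0) /\
  (forall i, rnorm (e i) = 1).

Definition in_ball (e : nat -> H) (Gam gam : nat -> K) (x : H) : Prop :=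
  rnorm (x - \sum_(i <oo) ((Gam i + gam i) / 2) *: e i)
    <= 2^-1 * Num.sqrt (\sum_(i <oo) rnorm (Gam i - gam i) ^+ 2).

Definition re_inner_ge0 (e : nat -> H) (Gam gam : nat -> K) (x : H) : Prop :=
  0 <= RC_re (inner H (\sum_(i <oo) Gam i *: e i - x)
                   (x - \sum_(i <oo) gam i *: e i)).

Definition admissible (e : nat -> H) (Gam gam : nat -> K) : Prop :=
  [/\ infinite_dimensional, orthonormal_family e, ell2 Gam, ell2 gam &
      0 < \sum_(i <oo) RC_re (Gam i * RC_conj (gam i))].

Definition bound1 (e : nat -> H) (Gam gam : nat -> K) (x : H) : R :=
  (\sum_(i <oo) RC_re ((RC_conj (Gam i) + RC_conj (gam i)) * inner H x (e i))) ^+ 2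
    / \sum_(i <oo) RC_re (Gam i * RC_conj (gam i)).

Definition bound2 (e : nat -> H) (Gam gam : nat -> K) (x : H) : R :=
  rnorm (\sum_(i <oo) ((RC_conj (Gam i) + RC_conj (gam i)) * inner H x (e i))) ^+ 2
    / \sum_(i <oo) RC_re (Gam i * RC_conj (gam i)).

Definition bound3 (e : nat -> H) (Gam gam : nat -> K) (x : H) : R :=
  (\sum_(i <oo) rnorm (Gam i + gam i) ^+ 2)
    / (\sum_(i <oo) RC_re (Gam i * RC_conj (gam i)))
    * \sum_(i <oo) rnorm (inner H x (e i)) ^+ 2.

Definition bessel_gap (e : nat -> H) (x : H) : R :=
  rnorm x ^+ 2 - \sum_(i <oo) rnorm (inner H x (e i)) ^+ 2.

Definition bound_gap (e : nat -> H) (Gam gam : nat -> K) (x : H) : R :=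
  (\sum_(i <oo) rnorm (Gam i - gam i) ^+ 2)
    / (\sum_(i <oo) RC_re (Gam i * RC_conj (gam i)))
    * \sum_(i <oo) rnorm (inner H x (e i)) ^+ 2.

End Hypotheses.

(* c0 is best possible in lhs <= c0 * rhs over the scalar field of kind k: for
   no smaller c does lhs <= c * rhs hold for all admissible data, the Hilbert
   space being one of the data. *)
Definition best_possible (R : realType) (k : scalar_kind) (c0 : R)
    (lhs rhs : forall H : hilbertSpace R k, (nat -> H) ->
       (nat -> RC_field R k) -> (nat -> RC_field R k) -> H -> R) : Prop :=
  forall c : R, c < c0 ->
    ~ (forall (H : hilbertSpace R k) (e : nat -> H)
         (Gam gam : nat -> RC_field R k) (x : H),
         admissible e Gam gam ->
         in_ball e Gam gam x \/ re_inner_ge0 e Gam gam x ->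
         lhs H e Gam gam x <= c * rhs H e Gam gam x).

(* Main.v *)
Require Import Defs.
From HB Require Import structures.
From mathcomp Require Import all_boot all_order all_algebra.
From mathcomp Require Import complex.
From mathcomp Require Import all_classical all_reals all_analysis.
From mathcomp Require Import ring lra.
Import Order.TTheory GRing.Theory Num.Theory.
Import numFieldNormedType.Exports.
Local Open Scope classical_set_scope.
Local Open Scope ring_scope.
Set Implicit Arguments.
Unset Strict Implicit.
Unset Printing Implicit Defensive.

(** Put G = sum Gam_i e_i, g = sum gam_i e_i and P = sum <x, e_i> e_i; the
    three series converge because H is complete, the last one by Bessel's
    inequality.  The inner product is continuous, so every series of the
    statement is an inner product or a squared norm of these vectors: with
    S := sum Re (Gam_i conj gam_i), one has S = Re <G, g>, the series of
    |Gam_i +- gam_i|^2 is |G +- g|^2, the one of (conj Gam_i + conj gam_i)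
    <x, e_i> is <x, G + g>, and the one of |<x, e_i>|^2 is |P|^2 (lemmas
    sum_re_Gam_gam to bessel_gapE).  What remains concerns four vectors.

    - Re <G - x, x - g> = |G - g|^2 / 4 - |x - (G + g) / 2|^2, so the two
      hypotheses on x are equivalent (ball_midpointE).
    - Re <G - x, x - g> >= 0 expands to |x|^2 + S <= Re <x, G + g>, and the
      first bound follows from 4 S |x|^2 <= (|x|^2 + S)^2
      (reverse_CauchySchwarz).
    - The second bound is |Re z| <= |z|; the third is Cauchy-Schwarz, after
      <x, G + g> = <P, G + g>, since P is the projection of x on the closed
      span of the e_i (inner_fourier_le).
    - Subtracting |P|^2 from the third bound turns |G + g|^2 into
      |G + g|^2 - 4 S = |G - g|^2, which is the bound on the Bessel gap.

    Sharpness needs one example, in which the four inequalities with the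
    constant 1/4 are equalities between nonzero numbers.  Let f be a unit
    vector orthogonal to all e_i, and Gam = (4, 0, 0, ...),
    gam = (1, 0, 0, ...).  On the sphere |x - (G + g) / 2| = |G - g| / 2, a
    vector x = a e_0 + b f has b^2 = (4 - a)(a - 1), and the ratio b^2 / a^2 is
    maximal at a = 8/5, where b = 6/5: then |x|^2 = 4, the bounds are 16 / 4,
    and the gap is 36 / 25 = (144 / 25) / 4 (extremal_example).  The example
    lives in l2 over the scalars, shown below to be a Hilbert space; the e_i
    are its standard basis vectors except the first, which is f. *)

(** * Real and complex scalars treated uniformly *)

Definition RC_ofR (R : realType) (k : scalar_kind) : R -> RC_field R k :=
  match k with
  | RealScalars => fun r : R => r
  | ComplexScalars => fun r : R => r%:C%C
  end.

Section Scalars.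
Variables (R : realType) (k : scalar_kind).
Local Notation K := (RC_field R k).
Local Notation ofR := (@RC_ofR R k).
Local Notation conj := (@RC_conj R k).
Local Notation re := (@RC_re R k).
Implicit Types (z w : K) (r s : R).

Fact RC_conj_is_zmod_morphism : zmod_morphism conj.
Proof. by case: k => [//|] x y; exact: (raddfB (@conjc R)). Qed.

Fact RC_conj_is_monoid_morphism : monoid_morphism conj.
Proof.
case: k => [|]; first by split.
by split=> [|x y]; [exact: (rmorph1 (@conjc R))|exact: (rmorphM (@conjc R))].
Qed.

HB.instance Definition _ :=
  GRing.isZmodMorphism.Build K K conj RC_conj_is_zmod_morphism.
HB.instance Definition _ :=
  GRing.isMonoidMorphism.Build K K conj RC_conj_is_monoid_morphism.

Fact RC_re_is_zmod_morphism : zmod_morphism re.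
Proof. by case: k => [//|] [a b] [c d]. Qed.

HB.instance Definition _ :=
  GRing.isZmodMorphism.Build K R re RC_re_is_zmod_morphism.

Fact RC_ofR_is_zmod_morphism : zmod_morphism ofR.
Proof. by case: k => [//|] x y; exact: (raddfB (real_complex R)). Qed.

Fact RC_ofR_is_monoid_morphism : monoid_morphism ofR.
Proof.
case: k => [|]; first by split.
by split=> [|x y]; [exact: (rmorph1 (real_complex R))
                  |exact: (rmorphM (real_complex R))].
Qed.

HB.instance Definition _ :=
  GRing.isZmodMorphism.Build R K ofR RC_ofR_is_zmod_morphism.
HB.instance Definition _ :=
  GRing.isMonoidMorphism.Build R K ofR RC_ofR_is_monoid_morphism.

Lemma RC_conjK : involutive conj.
Proof. by case: k => [//|]; exact: conjcK. Qed.

Lemma RC_re_conj z : re (conj z) = re z.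
Proof. by case: k z => [//|] [a b]. Qed.

Lemma RC_ofRK : cancel ofR re.
Proof. by case: k. Qed.

Lemma RC_conj_ofR r : conj (ofR r) = ofR r.
Proof. by case: k => [//|]; exact: conjc_real. Qed.

Lemma RC_re_ofRM r z : re (ofR r * z) = r * re z.
Proof. by case: k z => [//|] [a b] /=; rewrite mul0r subr0. Qed.

Lemma RC_le_ofR r s : (ofR r <= ofR s) = (r <= s).
Proof. by case: k => [//|]; exact: lecR. Qed.

Lemma RC_lt_ofR r s : (ofR r < ofR s) = (r < s).
Proof. by case: k => [//|]; exact: ltcR. Qed.

Lemma RC_ge0_ofR z : 0 <= z -> z = ofR (re z).
Proof. by case: k z => [//|] z z0 /=; rewrite RRe_real// ger0_real. Qed.

Lemma RC_re_ge0 z : 0 <= z -> 0 <= re z.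
Proof. by move=> z0; rewrite -RC_le_ofR -RC_ge0_ofR// rmorph0. Qed.

Lemma RC_re_gt0 z : 0 < z -> 0 < re z.
Proof. by move=> z0; rewrite -RC_lt_ofR -RC_ge0_ofR ?ltW// rmorph0. Qed.

(** Together with RC_le_ofR this replaces, for both kinds of scalars, the
    computations with real and imaginary parts. *)
Lemma RC_mulJ z : z * conj z = ofR (rnorm z ^+ 2).
Proof.
rewrite rmorphXn /= /rnorm -RC_ge0_ofR//; case: k z => [z|z] /=.
  by rewrite real_normK ?num_real.
exact: esym (sqr_normc z).
Qed.

Lemma RC_rnorm_conj z : rnorm (conj z) = rnorm z.
Proof.
case: k z => [//|z]; congr (complex.Re _); exact: normcJ.
Qed.

Lemma RC_normr_re z : `|re z| <= rnorm z.
Proof.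
rewrite -RC_le_ofR -(RC_ge0_ofR (normr_ge0 z)).
by case: k z => [//|z]; exact: normc_ge_Re.
Qed.

Lemma RC_rnorm_ofR r : rnorm (ofR r) = `|r|.
Proof.
case: k => [//|]; rewrite /rnorm [`|_|](normc_def (r%:C)%C) /=.
by rewrite expr0n/= addr0 sqrtr_sqr.
Qed.

End Scalars.

Section RealNorm.
Variables (R : realType) (k : scalar_kind).
Local Notation K := (RC_field R k).
Local Notation ofR := (@RC_ofR R k).

Section NormedZmod.
Variable V : normedZmodType K.
Implicit Types u v : V.

Lemma rnormK v : ofR (rnorm v) = `|v|.
Proof. exact/esym/RC_ge0_ofR. Qed.

Lemma rnorm_ge0 v : 0 <= rnorm v.
Proof. exact: RC_re_ge0. Qed.

Lemma rnorm0 : rnorm (0 : V) = 0.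
Proof. by rewrite /rnorm normr0 raddf0. Qed.

Lemma rnormB u v : rnorm (u - v) = rnorm (v - u).
Proof. by rewrite /rnorm distrC. Qed.

Lemma rnormD u v : rnorm (u + v) <= rnorm u + rnorm v.
Proof. by rewrite -(RC_le_ofR k) rmorphD/= !rnormK ler_normD. Qed.

Lemma rnorm_sum (I : Type) (r : seq I) (F : I -> V) :
  rnorm (\sum_(i <- r) F i) <= \sum_(i <- r) rnorm (F i).
Proof.
elim/big_rec2: _ => [|i y x _ xy]; first by rewrite rnorm0.
by rewrite (le_trans (rnormD _ _))// lerD2l.
Qed.

End NormedZmod.

Lemma rnormM (z w : K) : rnorm (z * w) = rnorm z * rnorm w.
Proof.
apply: (can_inj (@RC_ofRK R k)); rewrite rmorphM/= !rnormK.
exact: normrM.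
Qed.

Lemma rnormZ (V : normedModType K) (a : K) (v : V) :
  rnorm (a *: v) = rnorm a * rnorm v.
Proof.
apply: (can_inj (@RC_ofRK R k)); rewrite rmorphM/= !rnormK.
exact: normrZ.
Qed.

(** Convergence in a normed space over the scalars only involves real
    epsilons, since a positive scalar is a positive real. *)
Lemma cvg_rnormP (V : normedModType K) (T : Type) (F : set_system T)
    {FF : Filter F} (f : T -> V) (l : V) :
  f t @[t --> F] --> l <->
  (forall eps : R, 0 < eps -> \forall t \near F, rnorm (l - f t) < eps).
Proof.
split=> [/cvgrPdist_lt fl eps eps0|fl].
  have := fl (ofR eps); rewrite -(rmorph0 ofR) RC_lt_ofR => /(_ eps0).
  by apply: filterS => t; rewrite -rnormK RC_lt_ofR.
apply/cvgrPdist_lt => eps eps0; have := fl _ (RC_re_gt0 eps0).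
by apply: filterS => t; rewrite -(RC_lt_ofR k) rnormK -RC_ge0_ofR// ltW.
Qed.

End RealNorm.

(** * The norm of a positive definite form *)

Section DotForm.
Variables (R : realType) (k : scalar_kind).
Local Notation K := (RC_field R k).
Local Notation ofR := (@RC_ofR R k).
Local Notation conj := (@RC_conj R k).
Local Notation re := (@RC_re R k).
Variables (U : lmodType K) (f : {dot U for conj}).
Implicit Types (x y : U) (a : K).

Lemma dotZl a x y : f (a *: x) y = a * f x y.
Proof. exact: linearZl_LR. Qed.

Lemma dotZr a x y : f x (a *: y) = conj a * f x y.
Proof. exact: linearZr_LR. Qed.

Lemma dotC x y : f x y = conj (f y x).
Proof. by rewrite (@hermitian_subproof _ _ _ _ f) expr0 mul1r. Qed.

Lemma re_dotC x y : re (f x y) = re (f y x).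
Proof. by rewrite dotC RC_re_conj. Qed.

Lemma dot_ge0 x : 0 <= f x x.
Proof.
have [->|x0] := eqVneq x 0; first by rewrite linear0l.
exact/ltW/neq0_dnorm_gt0.
Qed.

Lemma dotxx x : f x x = ofR (re (f x x)).
Proof. exact/RC_ge0_ofR/dot_ge0. Qed.

Lemma dotBB x y : f (x - y) (x - y) = f x x - f x y - f y x + f y y.
Proof.
by rewrite linearDl !linearDr linearNl !linearNr/= linearNl opprK addrA.
Qed.

Lemma re_dotDD x y :
  re (f (x + y) (x + y)) = re (f x x) + 2 * re (f x y) + re (f y y).
Proof.
rewrite linearDl !linearDr !raddfD/= (re_dotC y x); ring.
Qed.

Lemma re_dotBB x y :
  re (f (x - y) (x - y)) = re (f x x) - 2 * re (f x y) + re (f y y).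
Proof. by rewrite re_dotDD linearNl !linearNr !raddfN/= opprK mulrN. Qed.

(** The classical argument: the form is nonnegative at f(y,y) x - f(x,y) y,
    where its value is f(y,y) (f(x,x) f(y,y) - |f(x,y)|^2). *)
Lemma dot_CauchySchwarz x y :
  rnorm (f x y) ^+ 2 <= re (f x x) * re (f y y).
Proof.
have [->|y0] := eqVneq y 0.
  by rewrite !linear0r rnorm0 raddf0 expr0n/= mulr0.
have B0 : 0 < re (f y y) by exact/RC_re_gt0/neq0_dnorm_gt0.
set A := re (f x x); set B := re (f y y) in B0 *; set N := rnorm (f x y) ^+ 2.
have Hz : f (f y y *: x - f x y *: y) (f y y *: x - f x y *: y)
          = ofR (B * (A * B - N)).
  have -> : ofR (B * (A * B - N)) =
            ofR B * (ofR A * ofR B - f x y * conj (f x y)).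
    by rewrite RC_mulJ rmorphM rmorphB rmorphM.
  rewrite dotBB !dotZl !dotZr (dotC y x) (dotxx y) -/B (dotxx x) -/A.
  rewrite RC_conj_ofR; ring.
have := dot_ge0 (f y y *: x - f x y *: y).
by rewrite Hz -(rmorph0 ofR) RC_le_ofR pmulr_rge0// subr_ge0.
Qed.

Definition dot_norm x : R := Num.sqrt (re (f x x)).

Lemma sqr_dot_norm x : dot_norm x ^+ 2 = re (f x x).
Proof. by rewrite sqr_sqrtr// RC_re_ge0// dot_ge0. Qed.

Lemma dot_norm_CauchySchwarz x y : rnorm (f x y) <= dot_norm x * dot_norm y.
Proof.
rewrite -(@ler_pXn2r _ 2)// ?nnegrE ?mulr_ge0 ?sqrtr_ge0 ?rnorm_ge0//.
by rewrite exprMn !sqr_dot_norm dot_CauchySchwarz.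
Qed.

Lemma dot_normD x y : dot_norm (x + y) <= dot_norm x + dot_norm y.
Proof.
rewrite -(@ler_pXn2r _ 2)// ?nnegrE ?addr_ge0 ?sqrtr_ge0//.
rewrite sqr_dot_norm re_dotDD -!sqr_dot_norm sqrrD lerD2r lerD2l.
have := dot_norm_CauchySchwarz x y.
have := le_trans (ler_norm _) (RC_normr_re (f x y)); lra.
Qed.

Lemma dot_normZ a x : dot_norm (a *: x) = rnorm a * dot_norm x.
Proof.
rewrite /dot_norm dotZl dotZr mulrA RC_mulJ RC_re_ofRM sqrtrM ?sqr_ge0//.
by rewrite sqrtr_sqr ger0_norm ?rnorm_ge0.
Qed.

Lemma dot_norm_eq0 x : dot_norm x = 0 -> x = 0.
Proof.
apply: contra_eq => /(@neq0_dnorm_gt0 _ _ _ f)/RC_re_gt0.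
by rewrite -sqrtr_gt0 => /gt_eqF ->.
Qed.

End DotForm.

(** * Series and orthonormal families in a Hilbert space *)

Section Series.
Variables (R : realType) (k : scalar_kind).
Local Notation K := (RC_field R k).

Lemma sum_ooE (F : numFieldType) (V : normedModType F) (u : nat -> V) (A : V) :
  series u @ \oo --> A -> \big[+%R/0]_(0 <= i <oo) u i = A.
Proof. by move=> uA; exact: (cvg_lim (@norm_hausdorff _ _) uA). Qed.

Lemma cvg_series_single (F : numFieldType) (V : normedModType F)
    (u : nat -> V) (j : nat) :
  (forall i, i != j -> u i = 0) -> series u @ \oo --> u j.
Proof.
move=> u0; apply: cvg_near_cst; exists j.+1 => // n /= jn; rewrite /series/=.
rewrite (bigD1_seq j) ?iota_uniq ?mem_index_iota//=.
by rewrite big1 ?addr0// => i /u0.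
Qed.

(** The exponent makes this usable both for the comparison test (p = 0) and
    for orthogonal series (p = 1), where Pythagoras controls the square of the
    norm of a block of terms. *)
Lemma cauchy_series_dominated (V : normedModType K) (p : nat) (u : nat -> V)
    (v : nat -> R) :
  (forall m n, rnorm (\sum_(m <= i < n) u i) ^+ p.+1 <= \sum_(m <= i < n) v i) ->
  cvgn (series v) -> cauchy (series u @ \oo).
Proof.
move=> uv /cauchy_cvgP/cauchy_seriesP cv; apply/cauchy_seriesP => eps eps0.
have e0 := RC_re_gt0 eps0.
have := cv _ (exprn_gt0 p.+1 e0); apply: filterS => -[m n] /= vmn.
rewrite (RC_ge0_ofR (ltW eps0)) -rnormK RC_lt_ofR.
rewrite -(@ltr_pXn2r _ p.+1)// ?nnegrE ?rnorm_ge0 ?ltW//.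
by rewrite (le_lt_trans (uv _ _))// (le_lt_trans (ler_norm _)).
Qed.

Lemma cvg_RC_re (T : Type) (F : set_system T) {FF : Filter F} (f : T -> K)
    (l : K) : f t @[t --> F] --> l -> RC_re (f t) @[t --> F] --> RC_re l.
Proof.
move=> /cvg_rnormP fl; apply/cvgrPdist_lt => eps eps0.
have := fl _ eps0; apply: filterS => t; apply: le_lt_trans.
by rewrite -raddfB RC_normr_re.
Qed.

Lemma cvg_series_RC_re (u : nat -> K) (l : K) :
  series u @ \oo --> l -> series (fun i => RC_re (u i)) @ \oo --> RC_re l.
Proof.
have -> : series (fun i => RC_re (u i)) = (fun n => RC_re (series u n)).
  by apply/funext => n; rewrite /series/= raddf_sum.
exact: cvg_RC_re.
Qed.

End Series.

Section Hilbert.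
Variables (R : realType) (k : scalar_kind) (H : hilbertSpace R k).
Local Notation K := (RC_field R k).
Local Notation conj := (@RC_conj R k).
Local Notation re := (@RC_re R k).
Local Notation "<| x , y |>" := (inner H x y) (format "<| x ,  y |>").
Implicit Types (x y A : H) (a b : nat -> K).

Lemma sqr_rnorm x : rnorm x ^+ 2 = re <|x, x|>.
Proof. by rewrite rnormE (sqr_dot_norm (inner H)). Qed.

Lemma hilbert_CauchySchwarz x y : rnorm <|x, y|> <= rnorm x * rnorm y.
Proof. by rewrite !(rnormE x) !(rnormE y) (dot_norm_CauchySchwarz (inner H)). Qed.

Lemma cvg_inner (T : Type) (F : set_system T) {FF : Filter F} (f : T -> H)
    A x : f t @[t --> F] --> A -> <|x, f t|> @[t --> F] --> <|x, A|>.
Proof.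
move=> /cvg_rnormP fA; apply/cvg_rnormP => eps eps0.
have x1 : 0 < rnorm x + 1 by rewrite ltr_wpDl// rnorm_ge0.
have := fA _ (divr_gt0 eps0 x1); apply: filterS => t.
rewrite ltr_pdivlMr// => tA; rewrite -linearBr.
rewrite (le_lt_trans (hilbert_CauchySchwarz _ _))// (le_lt_trans _ tA)//.
by rewrite mulrC ler_wpM2l ?rnorm_ge0// lerDl.
Qed.

Lemma cvg_series_inner a (e : nat -> H) A x :
  series (fun i => a i *: e i) @ \oo --> A ->
  series (fun i => conj (a i) * <|x, e i|>) @ \oo --> <|x, A|>.
Proof.
have -> : series (fun i => conj (a i) * <|x, e i|>) =
          (fun n => <|x, series (fun i => a i *: e i) n|>).
  apply/funext => n; rewrite /series/= linear_sumr/=.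
  by apply: eq_bigr => i _; rewrite dotZr.
exact: cvg_inner.
Qed.


Section Orthonormal.
Variable e : nat -> H.
Hypothesis e_on : orthonormal_family e.

Lemma inner_orthonormal i j : <|e i, e j|> = (i == j)%:R.
Proof.
case: e_on => e0 e1; have [<-|/eqP ij] := eqVneq i j; last exact: e0.
by rewrite dotxx -sqr_rnorm e1 expr1n rmorph1.
Qed.

(** The coefficients of a finite combination are recovered by inner products;
    r is an arbitrary list of indices so as to cover blocks m <= i < n. *)
Lemma inner_psum a (r : seq nat) j : uniq r ->
  <|\sum_(i <- r) a i *: e i, e j|> = if j \in r then a j else 0.
Proof.
move=> ur; rewrite linear_sumlz/=; case: ifPn => jr.
  rewrite (bigD1_seq j)//= big1 => [|i ij].
    by rewrite dotZl inner_orthonormal eqxx mulr1 addr0.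
  by rewrite dotZl inner_orthonormal (negPf ij) mulr0.
rewrite big1_seq// => i /andP[_ ir]; rewrite dotZl inner_orthonormal.
by rewrite (negPf (memPn jr i ir)) mulr0.
Qed.

Lemma sqr_rnorm_psum a (r : seq nat) : uniq r ->
  rnorm (\sum_(i <- r) a i *: e i) ^+ 2 = \sum_(i <- r) rnorm (a i) ^+ 2.
Proof.
move=> ur; rewrite sqr_rnorm linear_sumr/= raddf_sum/= big_seq [RHS]big_seq.
apply: eq_bigr => i ir.
by rewrite dotZr inner_psum// ir mulrC RC_mulJ RC_ofRK.
Qed.

Lemma cvg_series_ell2 a : ell2 a -> cvgn (series (fun i => a i *: e i)).
Proof.
move=> a2; apply: cauchy_cvg; apply: (@cauchy_series_dominated _ _ _ 1 _ _ _ a2).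
by move=> m n; rewrite sqr_rnorm_psum// iota_uniq.
Qed.

(** Bessel: the partial sum S of the Fourier series satisfies
    |S|^2 = <x,S> <= |x| |S|. *)
Lemma bessel_psum x n :
  \sum_(0 <= i < n) rnorm <|x, e i|> ^+ 2 <= rnorm x ^+ 2.
Proof.
rewrite -sqr_rnorm_psum ?iota_uniq//.
set S := \sum_(0 <= i < n) _.
have SxS : re <|x, S|> = rnorm S ^+ 2.
  rewrite sqr_rnorm /S; rewrite !linear_sumr/= !raddf_sum/= big_seq [RHS]big_seq.
  apply: eq_bigr => i ir; rewrite !dotZr inner_psum ?iota_uniq// ir//.
have := rnorm_ge0 S; rewrite le_eqVlt => /predU1P[<-|S0].
  by rewrite expr0n/= sqr_ge0.
rewrite ler_sqr ?nnegrE ?rnorm_ge0// -(ler_pM2r S0) -expr2 -SxS.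
apply: le_trans (hilbert_CauchySchwarz _ _).
exact: le_trans (ler_norm _) (RC_normr_re _).
Qed.

Lemma ell2_fourier x : ell2 (fun i => <|x, e i|>).
Proof.
apply: nondecreasing_is_cvgn.
  by apply: nondecreasing_series => i _ _; rewrite sqr_ge0.
by exists (rnorm x ^+ 2) => _ [n _ <-]; exact: bessel_psum.
Qed.

(** The series of <a_i e_i, e_j> has a single nonzero term. *)
Lemma inner_series_coef a A : series (fun i => a i *: e i) @ \oo --> A ->
  forall j, <|A, e j|> = a j.
Proof.
move=> aA j; rewrite dotC; apply: (can_inj (@RC_conjK R k)); rewrite RC_conjK.
rewrite -(sum_ooE (cvg_series_inner (x := e j) aA)).
apply: sum_ooE; rewrite -[X in _ --> X]mulr1 -[X in _ * X](_ : <|e j, e j|> = 1);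
  last by rewrite inner_orthonormal eqxx.
apply: (@cvg_series_single _ K (fun i => conj (a i) * <|e j, e i|>)) => i ij.
by rewrite inner_orthonormal eq_sym (negPf ij) mulr0.
Qed.

(** Parseval's identity, obtained from <A, B> = sum <A, b_i e_i>. *)
Lemma cvg_series_parseval a b A B :
  series (fun i => a i *: e i) @ \oo --> A ->
  series (fun i => b i *: e i) @ \oo --> B ->
  series (fun i => re (a i * conj (b i))) @ \oo --> re <|A, B|>.
Proof.
move=> aA bB; have := cvg_series_RC_re (cvg_series_inner (x := A) bB).
by under eq_fun do rewrite (inner_series_coef aA) mulrC.
Qed.

Lemma cvg_series_sqr_rnorm a A :
  series (fun i => a i *: e i) @ \oo --> A ->
  series (fun i => rnorm (a i) ^+ 2) @ \oo --> rnorm A ^+ 2.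
Proof.
move=> aA; have := cvg_series_parseval aA aA; rewrite sqr_rnorm.
by under eq_fun do rewrite RC_mulJ RC_ofRK.
Qed.

End Orthonormal.
End Hilbert.

(** * The inequalities *)

Section InnerProductInequalities.
Variables (R : realType) (k : scalar_kind) (H : hilbertSpace R k).
Local Notation K := (RC_field R k).
Local Notation conj := (@RC_conj R k).
Local Notation re := (@RC_re R k).
Local Notation "<| x , y |>" := (inner H x y) (format "<| x ,  y |>").
Implicit Types (x y A G g P : H).

Lemma sqr_rnormD x y :
  rnorm (x + y) ^+ 2 = rnorm x ^+ 2 + 2 * re <|x, y|> + rnorm y ^+ 2.
Proof. by rewrite !sqr_rnorm re_dotDD. Qed.

Lemma sqr_rnormB x y :
  rnorm (x - y) ^+ 2 = rnorm x ^+ 2 - 2 * re <|x, y|> + rnorm y ^+ 2.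
Proof. by rewrite !sqr_rnorm re_dotBB. Qed.

Lemma re_inner_segment x G g :
  re <|G - x, x - g|> =
  re <|x, G + g|> - re <|G, g|> - rnorm x ^+ 2.
Proof.
rewrite linearBl !linearBr !raddfB/= linearDr raddfD/= (re_dotC _ G x) sqr_rnorm.
ring.
Qed.

Lemma half_RC_ofR : (2^-1 : K) = RC_ofR k 2^-1.
Proof. by rewrite fmorphV rmorph_nat. Qed.

(** Polarisation: with m the midpoint of G and g and h their half difference,
    G - x = h - (x - m) and x - g = h + (x - m). *)
Lemma re_inner_midpoint x G g :
  re <|G - x, x - g|> =
  (2^-1 * rnorm (G - g)) ^+ 2 - rnorm (x - 2^-1 *: (G + g)) ^+ 2.
Proof.
rewrite re_inner_segment exprMn !sqr_rnormB dotZr half_RC_ofR RC_conj_ofR.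
rewrite RC_re_ofRM rnormZ RC_rnorm_ofR exprMn sqr_rnormD real_normK ?num_real//.
by field.
Qed.

Lemma ball_midpointE x G g :
  (rnorm (x - 2^-1 *: (G + g)) <= 2^-1 * rnorm (G - g)) =
  (0 <= re <|G - x, x - g|>).
Proof.
rewrite re_inner_midpoint subr_ge0 ler_sqr ?nnegrE ?rnorm_ge0//.
by rewrite mulr_ge0 ?rnorm_ge0// invr_ge0.
Qed.

(** From re <G - x, x - g> >= 0 one reads |x|^2 + re <G, g> <= re <x, G + g>,
    and 4 s t <= (s + t)^2. *)
Lemma reverse_CauchySchwarz x G g :
  0 < re <|G, g|> -> 0 <= re <|G - x, x - g|> ->
  rnorm x ^+ 2 <= 4^-1 * (re <|x, G + g|> ^+ 2 / re <|G, g|>).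
Proof.
rewrite re_inner_segment => S0 xGg; rewrite mulrA ler_pdivlMr//.
move: (rnorm x ^+ 2) (re _) (re _) (sqr_ge0 (rnorm x)) S0 xGg => n T S n0 S0 xGg.
have : 0 <= (T - S - n) * (T + S + n) by rewrite mulr_ge0//; lra.
have := sqr_ge0 (n - S); nra.
Qed.

End InnerProductInequalities.

Section BoundsAsInnerProducts.
Variables (R : realType) (k : scalar_kind) (H : hilbertSpace R k).
Local Notation K := (RC_field R k).
Local Notation conj := (@RC_conj R k).
Local Notation re := (@RC_re R k).
Local Notation "<| x , y |>" := (inner H x y) (format "<| x ,  y |>").
Variables (e : nat -> H) (Gam gam : nat -> K) (x G g P : H).
Hypothesis e_on : orthonormal_family e.
Hypothesis GamG : series (fun i => Gam i *: e i) @ \oo --> G.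
Hypothesis gamg : series (fun i => gam i *: e i) @ \oo --> g.
Hypothesis xP : series (fun i => <|x, e i|> *: e i) @ \oo --> P.

Let GgD : series (fun i => (Gam i + gam i) *: e i) @ \oo --> G + g.
Proof.
under eq_fun do rewrite scalerDl.
rewrite (seriesD (fun i => Gam i *: e i) (fun i => gam i *: e i)).
exact: cvgD.
Qed.

Let GgB : series (fun i => (Gam i - gam i) *: e i) @ \oo --> G - g.
Proof.
under eq_fun do rewrite scalerBl.
rewrite (seriesD (fun i => Gam i *: e i) (fun i => - (gam i *: e i))).
rewrite (seriesN (fun i => gam i *: e i)).
exact: cvgB.
Qed.

Lemma sum_re_Gam_gam : \sum_(i <oo) re (Gam i * conj (gam i)) = re <|G, g|>.
Proof. by apply: sum_ooE; exact: (cvg_series_parseval e_on). Qed.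

Lemma in_ballE :
  in_ball e Gam gam x <-> rnorm (x - 2^-1 *: (G + g)) <= 2^-1 * rnorm (G - g).
Proof.
rewrite /in_ball (sum_ooE (cvg_series_sqr_rnorm e_on GgB)) sqrtr_sqr.
rewrite ger0_norm ?rnorm_ge0//.
suff /sum_ooE -> : series (fun i => ((Gam i + gam i) / 2) *: e i) @ \oo -->
    2^-1 *: (G + g) by [].
under eq_fun do rewrite mulrC -scalerA.
rewrite (seriesZ (fun i => (Gam i + gam i) *: e i)).
exact: cvgZl_tmp.
Qed.

Lemma re_inner_ge0E : re_inner_ge0 e Gam gam x <-> 0 <= re <|G - x, x - g|>.
Proof. by rewrite /re_inner_ge0 (sum_ooE GamG) (sum_ooE gamg). Qed.

Lemma bound1E : bound1 e Gam gam x = re <|x, G + g|> ^+ 2 / re <|G, g|>.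
Proof.
rewrite /bound1 sum_re_Gam_gam; congr (_ ^+ 2 / _); apply: sum_ooE.
under eq_fun do rewrite -rmorphD.
exact/cvg_series_RC_re/cvg_series_inner.
Qed.

Lemma bound2E : bound2 e Gam gam x = rnorm <|x, G + g|> ^+ 2 / re <|G, g|>.
Proof.
rewrite /bound2 sum_re_Gam_gam; congr (rnorm _ ^+ 2 / _); apply: sum_ooE.
under eq_fun do rewrite -rmorphD.
exact/cvg_series_inner.
Qed.

Lemma bound3E :
  bound3 e Gam gam x = rnorm (G + g) ^+ 2 / re <|G, g|> * rnorm P ^+ 2.
Proof.
rewrite /bound3 sum_re_Gam_gam (sum_ooE (cvg_series_sqr_rnorm e_on GgD)).
by rewrite (sum_ooE (cvg_series_sqr_rnorm e_on xP)).
Qed.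

Lemma bound_gapE :
  bound_gap e Gam gam x = rnorm (G - g) ^+ 2 / re <|G, g|> * rnorm P ^+ 2.
Proof.
rewrite /bound_gap sum_re_Gam_gam (sum_ooE (cvg_series_sqr_rnorm e_on GgB)).
by rewrite (sum_ooE (cvg_series_sqr_rnorm e_on xP)).
Qed.

Lemma bessel_gapE : bessel_gap e x = rnorm x ^+ 2 - rnorm P ^+ 2.
Proof. by rewrite /bessel_gap (sum_ooE (cvg_series_sqr_rnorm e_on xP)). Qed.

(** Both sides are sum conj(a_i) <x, e_i>, as P has the same coefficients as x:
    P is the orthogonal projection of x on the closed span of e. *)
Lemma inner_fourier_sum a A :
  series (fun i => a i *: e i) @ \oo --> A -> <|x, A|> = <|P, A|>.
Proof.
move=> aA; rewrite -(sum_ooE (cvg_series_inner (x := x) aA)).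
rewrite -(sum_ooE (cvg_series_inner (x := P) aA)); congr (limn _).
apply/funext => n; apply: eq_bigr => i _.
by rewrite (inner_series_coef e_on xP).
Qed.

(** Cauchy-Schwarz applied to P instead of x, which gains |P| over |x|. *)
Lemma inner_fourier_le A a :
  series (fun i => a i *: e i) @ \oo --> A ->
  rnorm <|x, A|> ^+ 2 <= rnorm A ^+ 2 * rnorm P ^+ 2.
Proof.
move=> /inner_fourier_sum ->; rewrite -exprMn.
rewrite ler_sqr ?nnegrE ?mulr_ge0 ?rnorm_ge0//.
by rewrite mulrC hilbert_CauchySchwarz.
Qed.

(** P is orthogonal to x - P. *)
Lemma bessel : rnorm P ^+ 2 <= rnorm x ^+ 2.
Proof.
have := sqr_ge0 (rnorm (x - P)).
by rewrite sqr_rnormB (inner_fourier_sum xP) -sqr_rnorm; lra.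
Qed.

(** The gap estimate is the third bound minus |P|^2, because
    |G + g|^2 - 4 Re <G, g> = |G - g|^2. *)
Lemma bounds_of_re_inner_ge0 : 0 < re <|G, g|> -> 0 <= re <|G - x, x - g|> ->
  (rnorm x ^+ 2 <= 4^-1 * bound1 e Gam gam x <= 4^-1 * bound2 e Gam gam x
   /\ 4^-1 * bound2 e Gam gam x <= 4^-1 * bound3 e Gam gam x)
  /\ 0 <= bessel_gap e x <= 4^-1 * bound_gap e Gam gam x.
Proof.
move=> S0 xGg.
have le1 : rnorm x ^+ 2 <= 4^-1 * bound1 e Gam gam x.
  by rewrite bound1E reverse_CauchySchwarz.
have le2 : bound1 e Gam gam x <= bound2 e Gam gam x.
  rewrite bound1E bound2E ler_pM2r ?invr_gt0//.
  rewrite -real_normK ?num_real// ler_sqr ?nnegrE ?rnorm_ge0//.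
  exact: RC_normr_re.
have le3 : bound2 e Gam gam x <= bound3 e Gam gam x.
  rewrite bound2E bound3E [leRHS]mulrAC ler_pM2r ?invr_gt0//.
  exact: inner_fourier_le GgD.
have le4 : 0 <= bessel_gap e x by rewrite bessel_gapE subr_ge0 bessel.
have le5 : 4^-1 * bound_gap e Gam gam x =
           4^-1 * bound3 e Gam gam x - rnorm P ^+ 2.
  rewrite bound_gapE bound3E sqr_rnormB sqr_rnormD; field; exact: lt0r_neq0.
rewrite le4 le5 bessel_gapE; split; [split|]; lra.
Qed.

End BoundsAsInnerProducts.

(** * Completeness of the scalars *)

Section ScalarsComplete.
Variables (R : realType) (k : scalar_kind).
Local Notation K := (RC_field R k).

Lemma cauchy_rnormP (V : normedModType K) (F : set_system V)
    {FF : ProperFilter F} :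
  cauchy F <-> (forall eps : R, 0 < eps ->
                  exists x : V, \forall y \near F, rnorm (x - y) < eps).
Proof.
split=> [/cauchyP FC eps eps0|FC]; last first.
  apply/cauchyP => eps eps0; have [x Fx] := FC _ (RC_re_gt0 eps0).
  exists x; apply: filterS Fx => y xy; rewrite -ball_normE/= -rnormK.
  by rewrite [ltRHS](RC_ge0_ofR (ltW eps0)) RC_lt_ofR.
have /FC[x Fx] : 0 < RC_ofR k eps by rewrite -(rmorph0 (@RC_ofR R k)) RC_lt_ofR.
exists x; apply: filterS Fx => y; rewrite -ball_normE/= -rnormK.
by rewrite RC_lt_ofR.
Qed.

End ScalarsComplete.

Lemma rnorm_complex (R : realType) (z : RC_field R ComplexScalars) :
  rnorm z = Num.sqrt (complex.Re z ^+ 2 + complex.Im z ^+ 2).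
Proof. by rewrite /rnorm [`|_|]normc_def. Qed.

(** A Cauchy filter of complex numbers has Cauchy real and imaginary parts. *)
Lemma RC_complete (R : realType) (k : scalar_kind)
    (F : set_system (RC_field R k)) :
  ProperFilter F -> cauchy F -> cvg F.
Proof.
case: k F => F FF; first exact: R_complete.
move=> /(@cauchy_rnormP R ComplexScalars) FC.
have cvg_part (p : R[i] -> R) : (forall z w, p (z - w) = p z - p w) ->
    (forall z : R[i], p z ^+ 2 <= complex.Re z ^+ 2 + complex.Im z ^+ 2) ->
    cvg (p z @[z --> F]).
  move=> pB p_le; apply: R_complete; apply/cauchyP => eps eps0.
  have [x Fx] := FC _ eps0; exists (p x); apply: filterS Fx => y.
  rewrite -ball_normE/= -pB; apply: le_lt_trans.
  by rewrite [leRHS](rnorm_complex (x - y)) -sqrtr_sqr ler_wsqrtr.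
have /cvg_ex[a /cvgrPdist_lt Fa] : cvg (complex.Re z @[z --> F]).
  by apply: cvg_part => [[? ?] [? ?]//|z]; rewrite lerDl sqr_ge0.
have /cvg_ex[b /cvgrPdist_lt Fb] : cvg (complex.Im z @[z --> F]).
  by apply: cvg_part => [[? ?] [? ?]//|z]; rewrite lerDr sqr_ge0.
apply/cvg_ex; exists (a +i* b)%C.
apply/(@cvg_rnormP R ComplexScalars) => eps eps0.
have e2 : 0 < eps / 2 by rewrite divr_gt0.
apply: filterS2 (Fa _ e2) (Fb _ e2) => -[c d] ca db.
rewrite [ltLHS]rnorm_complex/= -(ger0_norm (ltW eps0)) -[ltRHS]sqrtr_sqr.
rewrite ltr_sqrt ?exprn_gt0//.
rewrite -[(a - c) ^+ 2]real_normK ?num_real// -[(b - d) ^+ 2]real_normK ?num_real//.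
move: `|a - c| `|b - d| (normr_ge0 (a - c)) (normr_ge0 (b - d)) ca db.
move=> u v u0 v0 ue ve.
have : 0 <= (eps / 2 - u) * (eps / 2 + u) by rewrite mulr_ge0//; lra.
have : 0 <= (eps / 2 - v) * (eps / 2 + v) by rewrite mulr_ge0//; lra.
have := mulr_gt0 eps0 eps0; nra.
Qed.

(** * The space of square-summable sequences *)

Section Continuity.
Variables (R : realType) (k : scalar_kind).
Local Notation K := (RC_field R k).

Lemma cvg_rnorm (V : normedModType K) (T : Type) (F : set_system T)
    {FF : Filter F} (f : T -> V) (l : V) :
  f t @[t --> F] --> l -> rnorm (f t) @[t --> F] --> rnorm l.
Proof.
move=> /cvg_rnormP fl; apply/cvgrPdist_lt => eps eps0.
apply: filterS (fl _ eps0) => t; apply: le_lt_trans.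
rewrite ler_norml lerBlDr lerNl opprB lerBlDr.
have := rnormD (l - f t) (f t); have := rnormD (f t - l) l.
by rewrite !subrK (rnormB (f t)) => -> ->.
Qed.

Lemma cvg_RC_conj (T : Type) (F : set_system T) {FF : Filter F} (f : T -> K)
    (l : K) : f t @[t --> F] --> l -> RC_conj (f t) @[t --> F] --> RC_conj l.
Proof.
move=> /cvg_rnormP fl; apply/cvg_rnormP => eps eps0.
by apply: filterS (fl _ eps0) => t; rewrite -rmorphB RC_rnorm_conj.
Qed.

Lemma cvg_RC_ofR (T : Type) (F : set_system T) {FF : Filter F} (f : T -> R)
    (l : R) : f t @[t --> F] --> l -> RC_ofR k (f t) @[t --> F] --> RC_ofR k l.
Proof.
move=> /cvgrPdist_lt fl; apply/cvg_rnormP => eps eps0.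
by apply: filterS (fl _ eps0) => t; rewrite -rmorphB RC_rnorm_ofR.
Qed.

End Continuity.

Section SquareSummable.
Variables (R : realType) (k : scalar_kind).
Local Notation K := (RC_field R k).
Local Notation conj := (@RC_conj R k).
Local Notation re := (@RC_re R k).
Implicit Types (a b : nat -> K) (c : K).

(** The partial sums are nondecreasing. *)
Lemma ell2_bounded a (M : R) :
  (forall n, \sum_(0 <= i < n) rnorm (a i) ^+ 2 <= M) -> ell2 a.
Proof.
move=> aM; apply: nondecreasing_is_cvgn.
  by apply: nondecreasing_series => i _ _; rewrite sqr_ge0.
by exists M => _ [n _ <-]; exact: aM.
Qed.

Lemma ell2_psum_le a n : ell2 a ->
  \sum_(0 <= i < n) rnorm (a i) ^+ 2 <= \sum_(i <oo) rnorm (a i) ^+ 2.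
Proof.
move=> a2; apply: (nondecreasing_cvgn_le _ a2).
by apply: nondecreasing_series => i _ _; rewrite sqr_ge0.
Qed.

Lemma sqr_rnormD_le2 (x y : K) :
  rnorm (x + y) ^+ 2 <= 2 * (rnorm x ^+ 2 + rnorm y ^+ 2).
Proof.
have := sqr_ge0 (rnorm x - rnorm y); have := rnorm_ge0 (x + y).
move: (rnormD x y) (rnorm_ge0 x) (rnorm_ge0 y); nra.
Qed.

Lemma ell2_submod_closed : submod_closed [pred a : nat -> K | `[< ell2 a >]].
Proof.
split=> [|c a b].
  apply/asboolP; apply: (@ell2_bounded _ 0) => n; rewrite big1// => i _.
  by rewrite rnorm0 expr0n.
move=> /asboolP a2 /asboolP b2; apply/asboolP.
apply: (@ell2_bounded _ (2 * (rnorm c ^+ 2 * \sum_(i <oo) rnorm (a i) ^+ 2 +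
   \sum_(i <oo) rnorm (b i) ^+ 2))) => n.
apply: (@le_trans _ _ (\sum_(0 <= i < n)
    2 * (rnorm c ^+ 2 * rnorm (a i) ^+ 2 + rnorm (b i) ^+ 2))).
  by apply: ler_sum => i _; rewrite -exprMn -rnormM; exact: sqr_rnormD_le2.
rewrite -mulr_sumr big_split/= -mulr_sumr ler_pM2l// lerD ?ell2_psum_le//.
by rewrite ler_wpM2l ?sqr_ge0 ?ell2_psum_le.
Qed.

HB.instance Definition _ := GRing.isSubmodClosed.Build K (nat -> K)
  [pred a : nat -> K | `[< ell2 a >]] ell2_submod_closed.

(** Absolute convergence, from |z w| <= |z|^2 + |w|^2. *)
Lemma cvg_series_mul_ell2 a b : ell2 a -> ell2 b ->
  cvgn (series (fun i => a i * conj (b i))).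
Proof.
move=> a2 b2; apply: RC_complete.
apply: (@cauchy_series_dominated _ _ K 0 _
  (fun i => rnorm (a i) ^+ 2 + rnorm (b i) ^+ 2)).
  move=> m n; rewrite expr1; apply: le_trans (rnorm_sum _ _) _.
  apply: ler_sum => i _; rewrite rnormM RC_rnorm_conj.
  have := sqr_ge0 (rnorm (a i) - rnorm (b i)).
  have := mulr_ge0 (rnorm_ge0 (a i)) (rnorm_ge0 (b i)); nra.
exact: (is_cvg_seriesD a2 b2).
Qed.

Record l2 := L2 { l2_val :> nat -> K; _ : l2_val \in [pred a | `[< ell2 a >]] }.

HB.instance Definition _ := [isSub for l2_val].
HB.instance Definition _ := [Choice of l2 by <:].
HB.instance Definition _ := [SubChoice_isSubLmodule of l2 by <:].

Lemma l2P (a : l2) : ell2 a.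
Proof. by case: a => a /= /asboolP. Qed.

Definition l2_of a (a2 : ell2 a) : l2 := @L2 a (asboolT a2).

Definition l2_dot (a b : l2) : K := \sum_(i <oo) a i * conj (b i).

Lemma cvg_l2_dot (a b : l2) :
  series (fun i => a i * conj (b i)) @ \oo --> l2_dot a b.
Proof. exact: (cvg_series_mul_ell2 (@l2P a) (@l2P b)). Qed.

Lemma l2_dot_linearl (b : l2) : GRing.linear_for *%R (l2_dot^~ b).
Proof.
move=> c a a'; apply: sum_ooE.
under eq_fun do rewrite [l2_val _ _]/= mulrDl -mulrA.
rewrite (seriesD (fun i => c * (a i * conj (b i))) (fun i => a' i * conj (b i))).
rewrite (seriesZ (fun i => a i * conj (b i) : K^o)).
by apply: cvgD; [apply: (@cvgZl_tmp _ K^o)|]; exact: cvg_l2_dot.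
Qed.

Lemma l2_dotC (a b : l2) : l2_dot a b = conj (l2_dot b a).
Proof.
apply: sum_ooE.
have -> : series (fun i => a i * conj (b i)) =
          (fun n => conj (series (fun i => b i * conj (a i)) n)).
  apply/funext => n; rewrite /series/= rmorph_sum/=.
  by apply: eq_bigr => i _; rewrite rmorphM/= RC_conjK mulrC.
exact: (cvg_RC_conj (@cvg_l2_dot b a)).
Qed.

Lemma l2_dot_linearr (a : l2) : GRing.linear_for (conj \; *%R) (l2_dot a).
Proof.
move=> c b b'; rewrite l2_dotC l2_dot_linearl rmorphD rmorphM/=.
by rewrite -!l2_dotC.
Qed.

Lemma l2_dotxx (a : l2) :
  l2_dot a a = RC_ofR k (\sum_(i <oo) rnorm (a i) ^+ 2).
Proof.
apply: sum_ooE.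
have -> : series (fun i => a i * conj (a i)) =
          (fun n => RC_ofR k (series (fun i => rnorm (a i) ^+ 2) n)).
  apply/funext => n; rewrite /series/= rmorph_sum/=.
  by apply: eq_bigr => i _; rewrite RC_mulJ.
apply: cvg_RC_ofR; exact: (@l2P a).
Qed.

Lemma l2_coef_le (a : l2) j :
  rnorm (a j) ^+ 2 <= \sum_(i <oo) rnorm (a i) ^+ 2.
Proof.
apply: le_trans (ell2_psum_le j.+1 (@l2P a)).
by rewrite big_nat_recr//= lerDr sumr_ge0// => i _; rewrite sqr_ge0.
Qed.

Lemma l2_dot_gt0 (a : l2) : a != 0 -> 0 < l2_dot a a.
Proof.
move=> a0; rewrite l2_dotxx -(rmorph0 (@RC_ofR R k)) RC_lt_ofR.
have /existsNP[j /eqP aj] : ~ (forall j, a j = 0).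
  by apply: contra_not (negP a0) => aj; apply/eqP/val_inj/funext.
apply: lt_le_trans (l2_coef_le a j).
rewrite exprn_gt0// -(RC_lt_ofR k) rnormK rmorph0 normr_gt0//.
Qed.

HB.instance Definition _ := bilinear_isBilinear.Build K l2 l2 K
  (GRing.Scale.Law.clone _ _ *%R _) (GRing.Scale.Law.clone _ _ (conj \; *%R) _)
  l2_dot (Logic.conj l2_dot_linearl l2_dot_linearr).

End SquareSummable.

Section L2Hilbert.
Variables (R : realType) (k : scalar_kind).
Local Notation K := (RC_field R k).
Local Notation conj := (@RC_conj R k).
Local Notation re := (@RC_re R k).
Local Notation l2 := (l2 R k).
Local Notation l2_dot := (@l2_dot R k).

Fact l2_dot_hermitian (a b : l2) :
  l2_dot a b = (-1) ^+ false * conj (l2_dot b a).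
Proof. by rewrite expr0 mul1r l2_dotC. Qed.

HB.instance Definition _ :=
  isHermitianSesquilinear.Build K l2 false conj l2_dot l2_dot_hermitian.
HB.instance Definition _ :=
  isDotProduct.Build K l2 l2_dot (@l2_dot_gt0 R k).

(** The form is what norms the space, so it is packaged before the norm
    exists; its norm satisfies the axioms by Cauchy-Schwarz. *)
Definition l2_form : {dot l2 for conj} := l2_dot.

Fact l2_normD (a b : l2) :
  RC_ofR k (dot_norm l2_form (a + b)) <=
  RC_ofR k (dot_norm l2_form a) + RC_ofR k (dot_norm l2_form b).
Proof. by rewrite -rmorphD RC_le_ofR dot_normD. Qed.

Fact l2_normZ (c : K) (a : l2) :
  RC_ofR k (dot_norm l2_form (c *: a)) = `|c| * RC_ofR k (dot_norm l2_form a).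
Proof. by rewrite dot_normZ rmorphM/= rnormK. Qed.

Fact l2_norm_eq0 (a : l2) : RC_ofR k (dot_norm l2_form a) = 0 -> a = 0.
Proof.
rewrite -(rmorph0 (@RC_ofR R k)) => /(can_inj (@RC_ofRK R k)).
exact: dot_norm_eq0.
Qed.

HB.instance Definition _ :=
  Lmodule_isNormed.Build K l2 l2_normD l2_normZ l2_norm_eq0.

Lemma l2_rnormE (a : l2) : rnorm a = Num.sqrt (re (l2_dot a a)).
Proof. by rewrite /rnorm/= RC_ofRK. Qed.

Lemma l2_sqr_rnorm (a : l2) : rnorm a ^+ 2 = \sum_(i <oo) rnorm (a i) ^+ 2.
Proof. by rewrite l2_rnormE (sqr_dot_norm l2_form)/= l2_dotxx RC_ofRK. Qed.

Lemma l2_rnorm_coef (a : l2) j : rnorm (a j) <= rnorm a.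
Proof.
by rewrite -ler_sqr ?nnegrE ?rnorm_ge0// l2_sqr_rnorm l2_coef_le.
Qed.

(** A Cauchy filter converges coordinatewise, and the bounds on finitely many
    coordinates pass to the limit. *)
Lemma l2_complete (F : set_system l2) : ProperFilter F -> cauchy F -> cvg F.
Proof.
move=> FF /cauchy_rnormP FC.
have lim_coef : forall i, exists z : K, (a : l2) i @[a --> F] --> z.
  move=> i; apply/cvg_ex; apply: RC_complete.
  apply/(@cauchy_rnormP R k K) => eps eps0.
  have [x Fx] := FC _ eps0; exists (x i); apply: filterS Fx => y.
  exact: le_lt_trans (l2_rnorm_coef (x - y) i).
have [l Fl] := choice lim_coef.
have near_l (x : l2) eps : (\forall y \near F, rnorm (x - y) < eps) ->
    forall n, \sum_(0 <= i < n) rnorm (x i - l i) ^+ 2 <= eps ^+ 2.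
  move=> Fx n.
  apply: (@cvgr_to_le _ F _ _
    (fun y : l2 => \sum_(0 <= i < n) rnorm (x i - y i) ^+ 2)).
    apply: cvg_big => [|i _]; first exact: add_continuous.
    rewrite expr2; under eq_fun do rewrite expr2.
    by apply: cvgM; apply: cvg_rnorm; apply: cvgB => //; exact: cvg_cst.
  apply: filterS Fx => y xy.
  apply: le_trans (ell2_psum_le n (@l2P _ _ (x - y))) _.
  rewrite -l2_sqr_rnorm ler_sqr ?nnegrE ?rnorm_ge0//; first exact: ltW.
  exact: le_trans (rnorm_ge0 (x - y)) (ltW xy).
have l_ell2 : ell2 l.
  have [x /near_l xl] := FC _ ltr01.
  have xl2 : ell2 (fun i => x i - l i) by apply: (@ell2_bounded _ _ _ (1 ^+ 2)).
  have -> : l = (x - l2_of xl2 : l2) :> (nat -> K).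
    by apply/funext => i /=; rewrite [RHS]subKr.
  exact: l2P.
apply/cvg_ex; exists (l2_of l_ell2); apply/cvg_rnormP => eps eps0.
have e2 : 0 < eps / 2 by rewrite divr_gt0.
have [x Fx] := FC _ e2.
have xl : rnorm (x - l2_of l_ell2 : l2) <= eps / 2.
  rewrite -ler_sqr ?nnegrE ?rnorm_ge0 ?(ltW e2)// l2_sqr_rnorm.
  apply: (cvgr_to_le (@l2P _ _ (x - l2_of l_ell2))).
  by apply: nearW => n; exact: near_l.
apply: filterS (Fx) => y xy; rewrite [ltRHS]splitr.
rewrite -(subrK x (l2_of _)) -addrA (le_lt_trans (rnormD _ _))//.
by rewrite ler_ltD// rnormB.
Qed.

HB.instance Definition _ := Uniform_isComplete.Build l2 l2_complete.

Definition l2_hilbert : hilbertSpace R k :=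
  @HilbertSpace R k l2 l2_form l2_rnormE.

Definition delta_seq (j : nat) : nat -> K := fun i => (i == j)%:R.

Lemma ell2_delta_seq j : ell2 (delta_seq j).
Proof.
apply: (cvgP (rnorm (delta_seq j j) ^+ 2)).
apply: (@cvg_series_single _ R (fun i => rnorm (delta_seq j i) ^+ 2)) => i ij.
by rewrite /delta_seq (negPf ij) rnorm0 expr0n.
Qed.

Definition l2_basis (j : nat) : l2 := l2_of (@ell2_delta_seq j).

Lemma l2_dot_basis i j : l2_dot (l2_basis i) (l2_basis j) = (i == j)%:R.
Proof.
have -> : (i == j)%:R = l2_basis i i * conj (l2_basis j i).
  by rewrite /= /delta_seq eqxx mul1r rmorph_nat.
apply: sum_ooE.
apply: (@cvg_series_single _ K (fun n => l2_basis i n * conj (l2_basis j n))).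
by move=> n ni; rewrite /= /delta_seq (negPf ni) mul0r.
Qed.

Lemma l2_basis_orthonormal : orthonormal_family (l2_basis : nat -> l2_hilbert).
Proof.
split=> [i j /eqP ij|i]; first by rewrite [LHS]l2_dot_basis (negPf ij).
rewrite rnormE [inner _ _ _]l2_dot_basis eqxx -(rmorph1 (@RC_ofR R k)) RC_ofRK.
by rewrite sqrtr1.
Qed.

End L2Hilbert.

(** * Sharpness *)

Section Extremal.
Variables (R : realType) (k : scalar_kind) (H : hilbertSpace R k).
Local Notation K := (RC_field R k).
Local Notation ofR := (@RC_ofR R k).
Local Notation conj := (@RC_conj R k).
Local Notation re := (@RC_re R k).
Local Notation "<| x , y |>" := (inner H x y) (format "<| x ,  y |>").
Variable e : nat -> H.
Hypothesis e_on : orthonormal_family e.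

(** If n vectors f spanned H, expressing e 0, ..., e n in terms of f would give
    a matrix with more rows than columns, and a vector in its left kernel is a
    linear relation between the e j. *)
Lemma orthonormal_infinite_dimensional : infinite_dimensional H.
Proof.
move=> n f; apply: contrapT => /forallNP f_span.
have in_span (j : nat) : exists a : 'I_n -> K, e j = \sum_(i < n) a i *: f i.
  by have /existsNP[a /contrapT ->] := f_span (e j); exists a.
have [c ec] := choice in_span.
pose A : 'M[K]_(n.+1, n) := \matrix_(j, i) c j i.
have /rowV0Pn[v /sub_kermxP vA v0] : kermx A != 0.
  by rewrite kermx_eq0 /row_free neq_ltn ltnS rank_leq_col.
have ve0 : \sum_(j < n.+1) v 0 j *: e j = 0.
  under eq_bigr do rewrite ec scaler_sumr.
  rewrite exchange_big big1//= => i _.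
  under eq_bigr do rewrite scalerA.
  rewrite -scaler_suml; have /matrixP/(_ 0 i) := vA.
  rewrite !mxE; under eq_bigr do rewrite mxE.
  by move=> ->; rewrite scale0r.
case/eqP: v0; apply/rowP => j; rewrite mxE.
have : <|\sum_(j < n.+1) v 0 j *: e j, e j|> = 0 by rewrite ve0 linear0l.
rewrite linear_sumlz/= (bigD1 j)//= big1 => [|i ij].
  by rewrite dotZl inner_orthonormal// eqxx mulr1 addr0.
by rewrite dotZl inner_orthonormal// (negPf ij : (i == j :> nat) = false) mulr0.
Qed.

Variable f : H.
Hypotheses (f_unit : rnorm f = 1) (f_orth : forall i, <|f, e i|> = 0).

Definition extremal_Gam : nat -> K := fun i => if i == 0%N then ofR 4 else 0.
Definition extremal_gam : nat -> K := fun i => if i == 0%N then ofR 1 else 0.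
(** The tangent from the origin to the circle with diameter [1, 4] touches it
    at the point (8/5, 6/5). *)
Definition extremal_x : H := ofR (8 / 5) *: e 0%N + ofR (6 / 5) *: f.

(** Both sides of each inequality with constant 1/4 agree here: 4 = 16 / 4 and
    36 / 25 = (144 / 25) / 4. *)
Lemma extremal_example :
  [/\ admissible e extremal_Gam extremal_gam,
      re_inner_ge0 e extremal_Gam extremal_gam extremal_x &
  [/\ rnorm extremal_x ^+ 2 = 4,
      bound1 e extremal_Gam extremal_gam extremal_x = 16,
      bound2 e extremal_Gam extremal_gam extremal_x = 16 &
      bound3 e extremal_Gam extremal_gam extremal_x = 16] /\
   bessel_gap e extremal_x = 36 / 25 /\
   bound_gap e extremal_Gam extremal_gam extremal_x = 144 / 25].
Proof.
have supp0 (a : nat -> K) r : (forall i, a i = if i == 0%N then ofR r else 0) ->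
    series (fun i => a i *: e i) @ \oo --> ofR r *: e 0%N.
  move=> aE; have := @cvg_series_single _ H (fun i => a i *: e i) 0%N.
  rewrite [a 0%N]aE; apply => i i0; rewrite aE (negPf i0) scale0r//.
have ell0 (r : R) : ell2 (fun i => if i == 0%N then ofR r else 0).
  by apply/cvgP/(cvg_series_sqr_rnorm e_on (supp0 _ r _)).
have GamG := supp0 extremal_Gam 4 (fun=> erefl).
have gamg := supp0 extremal_gam 1 (fun=> erefl).
have e00 : <|e 0%N, e 0%N|> = 1 by rewrite inner_orthonormal.
have ee (r s : R) : <|ofR r *: e 0%N, ofR s *: e 0%N|> = ofR (r * s).
  by rewrite dotZl dotZr e00 mulr1 RC_conj_ofR -rmorphM.
have ne (r : R) : rnorm (ofR r *: e 0%N) ^+ 2 = r ^+ 2.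
  by rewrite sqr_rnorm ee RC_ofRK expr2.
have xe i : <|extremal_x, e i|> = if i == 0%N then ofR (8 / 5) else 0.
  rewrite linearDl/= !dotZl f_orth mulr0 addr0 inner_orthonormal// eq_sym.
  by case: eqP => _; rewrite (mulr1, mulr0).
have xP := supp0 _ (8 / 5) xe.
have nx : rnorm extremal_x ^+ 2 = 4.
  rewrite sqr_rnormD ne rnormZ f_unit mulr1 RC_rnorm_ofR real_normK ?num_real//.
  rewrite dotZl dotZr (dotC _ _ f) f_orth rmorph0 !mulr0 raddf0; by field.
have GgE : ofR 4 *: e 0%N + ofR 1 *: e 0%N = ofR 5 *: e 0%N.
  by rewrite -scalerDl -rmorphD; congr (ofR _ *: _); ring.
have GgBE : ofR 4 *: e 0%N - ofR 1 *: e 0%N = ofR 3 *: e 0%N.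
  by rewrite -scalerBl -rmorphB; congr (ofR _ *: _); ring.
have xG (r : R) : <|extremal_x, ofR r *: e 0%N|> = ofR (8 / 5 * r).
  by rewrite dotZr xe/= RC_conj_ofR -rmorphM mulrC.
split.
- split=> //.
  + exact: orthonormal_infinite_dimensional.
  + exact: ell0.
  + exact: ell0.
  + by rewrite (sum_re_Gam_gam e_on GamG gamg) ee RC_ofRK mulr1.
- apply/(re_inner_ge0E _ GamG gamg).
  rewrite re_inner_segment GgE xG ee !RC_ofRK nx; lra.
- rewrite (bound1E _ e_on GamG gamg) (bound2E _ e_on GamG gamg).
  rewrite (bound3E e_on GamG gamg xP) (bound_gapE e_on GamG gamg xP).
  rewrite (bessel_gapE e_on xP) nx GgE GgBE !ne xG ee !RC_ofRK RC_rnorm_ofR.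
  rewrite real_normK ?num_real//.
  by split; [split=> //; by field|split; by field].
Qed.

End Extremal.

(** A constant attained by a single example with a positive right-hand side
    cannot be lowered. *)
Lemma best_possible_attained (R : realType) (k : scalar_kind) (c0 : R)
    (lhs rhs : forall H : hilbertSpace R k, (nat -> H) ->
       (nat -> RC_field R k) -> (nat -> RC_field R k) -> H -> R)
    (H : hilbertSpace R k) (e : nat -> H) (Gam gam : nat -> RC_field R k)
    (x : H) :
  admissible e Gam gam -> re_inner_ge0 e Gam gam x ->
  0 < rhs H e Gam gam x -> lhs H e Gam gam x = c0 * rhs H e Gam gam x ->
  best_possible c0 lhs rhs.
Proof.
move=> adm xGg rhs0 lhsE c cc0 /(_ H e Gam gam x adm (or_intror xGg)).
by rewrite lhsE ler_pM2r// leNgt cc0.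
Qed.

Theorem theorem6 (R : realType) (k : scalar_kind) :
  (forall (H : hilbertSpace R k) (e : nat -> H) (Gam gam : nat -> RC_field R k),
     admissible e Gam gam ->
     forall x : H,
       (in_ball e Gam gam x <-> re_inner_ge0 e Gam gam x) /\
       (in_ball e Gam gam x \/ re_inner_ge0 e Gam gam x ->
          (rnorm x ^+ 2 <= 4^-1 * bound1 e Gam gam x
             <= 4^-1 * bound2 e Gam gam x
           /\ 4^-1 * bound2 e Gam gam x <= 4^-1 * bound3 e Gam gam x)
          /\ 0 <= bessel_gap e x <= 4^-1 * bound_gap e Gam gam x)) /\
  best_possible 4^-1 (fun (H : hilbertSpace R k) _ _ _ x => rnorm x ^+ 2)
                (@bound1 R k) /\
  best_possible 4^-1 (fun (H : hilbertSpace R k) _ _ _ x => rnorm x ^+ 2)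
                (@bound2 R k) /\
  best_possible 4^-1 (fun (H : hilbertSpace R k) _ _ _ x => rnorm x ^+ 2)
                (@bound3 R k) /\
  best_possible 4^-1 (fun (H : hilbertSpace R k) e _ _ x => bessel_gap e x)
                (@bound_gap R k).
Proof.
split.
  move=> H e Gam gam [_ e_on /(cvg_series_ell2 e_on) GamG].
  move=> /(cvg_series_ell2 e_on) gamg S0 x.
  have xP := cvg_series_ell2 e_on (@ell2_fourier _ _ _ e e_on x).
  have ball_inner : in_ball e Gam gam x <-> re_inner_ge0 e Gam gam x.
    rewrite (in_ballE _ e_on GamG gamg) (re_inner_ge0E _ GamG gamg).
    by rewrite ball_midpointE.
  split=> // ball_or_inner.
  have /(re_inner_ge0E _ GamG gamg) xGg : re_inner_ge0 e Gam gam x.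
    by case: ball_or_inner => // /ball_inner.
  apply: (bounds_of_re_inner_ge0 e_on GamG gamg xP) => //.
  by rewrite -(sum_re_Gam_gam e_on GamG gamg).
pose H := l2_hilbert R k.
have [d_orth d_unit] := l2_basis_orthonormal R k.
pose e (i : nat) : H := l2_basis R k i.+1.
have e_on : orthonormal_family e.
  by split=> [i j ij|i]; [apply: d_orth => -[]|exact: d_unit].
have f_orth i : inner H (l2_basis R k 0) (e i) = 0 by exact: d_orth.
have [adm xGg [[nx b1 b2 b3] [gap bgap]]] :=
  extremal_example e_on (d_unit 0%N) f_orth.
split; [|split; [|split]];
  apply: (best_possible_attained adm xGg); rewrite ?nx ?b1 ?b2 ?b3 ?gap ?bgap;
  lra.
Qed.
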